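(* Let $q$ be a prime power, $r\ge 2$ an integer, and $u$ a positive integer with $u \mid \frac{q^r-1}{q-1}$. Let $\mathcal{X}_u=\{(\alpha,\beta)\in\mathbb{F}_{q^r}^2 : \alpha^u = Tr(\beta)\}$, where $Tr(y)=y^{q^{r-1}}+y^{q^{r-2}}+\cdots+y^q+y$. Let $P=(\alpha,\beta)\in\mathcal{X}_u$. Then the polynomial $$f_P(x,y) := c\left(\frac{x^{(q-1)u+1}-x}{x-\alpha}\right)\left(\frac{Tr(y)-Tr(\beta)}{y-\beta}\right)$$ is the standard indicator function of $P$, where $c:=-1$ if $\alpha=0$ and $c:=(-u)^{-1}\in\mathbb{F}_q$ otherwise. In particular, $y^{q^{r-1}-1}x^{(q-1)u}$ is the leading monomial of the standard indicator function of $P$.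
   Context: Polynomials live in $\mathbb{F}_{q^r}[x,y]$, and leading monomials are taken with respect to the lexicographic order $\prec$ with $x\prec y$. Let $I_{\mathcal{X}_u}=(Tr(y)-x^u,\ x^{q^r}-x,\ y^{q^r}-y)\subseteq\mathbb{F}_{q^r}[x,y]$; this is the ideal of all polynomials vanishing on $\mathcal{X}_u$. The footprint $\Delta_{\prec}(I_{\mathcal{X}_u})$ is the set of monomials that are not the leading monomial of any nonzero element of $I_{\mathcal{X}_u}$ (equivalently, that are not multiples of the leading monomial of any element of a Gröbner basis of $I_{\mathcal{X}_u}$). For $P\in\mathcal{X}_u$, the standard indicator function of $P$ is the unique $\mathbb{F}_{q^r}$-linear combination $f_P$ of monomials in $\Delta_{\prec}(I_{\mathcal{X}_u})$ such that $f_P(P)=1$ and $f_P(Q)=0$ for every $Q\in\mathcal{X}_u\setminus\{P\}$. The integer $u$ is viewed as an element of $\mathbb{F}_q$ via $\mathbb{Z}\to\mathbb{F}_q$. *)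

(* Defs.v *)
From HB Require Import structures.
From mathcomp Require Import all_boot all_order all_algebra.
From mathcomp Require Import mpoly.

Set Implicit Arguments.
Unset Strict Implicit.
Unset Printing Implicit Defensive.

Import Order.TTheory GRing.Theory.
Local Open Scope ring_scope.

Definition prime_power (q : nat) : Prop :=
  exists p k : nat, [/\ prime p, (0 < k)%N & q = (p ^ k)%N].

(* Used on the field (trace of an element) as well as on polynomial rings
   (the polynomial Tr(y)). *)
Definition Tr (R : nzRingType) (q r : nat) (z : R) : R :=
  \sum_(i < r) z ^+ (q ^ i).

Definition ideal_gen (R : nzRingType) (gs : seq R) (f : R) : Prop :=
  exists a : 'I_(size gs) -> R, f = \sum_(i < size gs) a i * gs`_i.

(* F[x, y] is {mpoly F[2]}, with x and y the variables of index 0 and 1. *)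
Definition ix : 'I_2 := ord0.
Definition iy : 'I_2 := ord_max.

(* The monomial order is lexicographic with x smaller than y, so the exponent
   of y is compared first; the order that mpoly puts on 'X_{1..2} (and hence
   its mlead) is graded, so it cannot be used here. *)
Definition lex_key (m : 'X_{1..2}) : nat *l nat := (m iy, m ix).

Definition lex_le (m m' : 'X_{1..2}) : bool := (lex_key m <= lex_key m')%O.

Section Indicator.

Variable F : finFieldType.
Implicit Types (f g : {mpoly F[2]}) (m : 'X_{1..2}) (P Q : F * F).

Definition leading_monomial f m : Prop :=
  m \in msupp f /\ forall m', m' \in msupp f -> lex_le m' m.

Definition footprint (I : {mpoly F[2]} -> Prop) m : Prop :=
  ~ exists f, [/\ I f, f != 0 & leading_monomial f m].

Definition eval2 f P : F := f.@[fun i => if i == ix then P.1 else P.2].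

Definition ptsX (q r u : nat) : {set F * F} :=
  [set P | P.1 ^+ u == Tr q r P.2].

Definition idealX (q r u : nat) : {mpoly F[2]} -> Prop :=
  let x : {mpoly F[2]} := 'X_ix in
  let y : {mpoly F[2]} := 'X_iy in
  ideal_gen [:: Tr q r y - x ^+ u; x ^+ (q ^ r) - x; y ^+ (q ^ r) - y].

Definition footprint_indicator (q r u : nat) P f : Prop :=
  [/\ forall m, m \in msupp f -> footprint (idealX q r u) m,
      eval2 f P = 1
    & forall Q, Q \in ptsX q r u -> Q != P -> eval2 f Q = 0].

Definition standard_indicator (q r u : nat) P f : Prop :=
  unique (footprint_indicator q r u P) f.

(* The two factors are univariate quotients, later evaluated at x and y. *)
Definition x_num (q u : nat) : {poly F} := 'X^((q - 1) * u + 1) - 'X.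

Definition y_num (q r : nat) (b : F) : {poly F} :=
  Tr q r 'X - (Tr q r b)%:P.

Definition fP_coef (u : nat) (a : F) : F :=
  if a == 0 then -1 else (- u%:R)^-1.

Definition fP (q r u : nat) P : {mpoly F[2]} :=
  let x : {mpoly F[2]} := 'X_ix in
  let y : {mpoly F[2]} := 'X_iy in
  fP_coef u P.1 *: (horner_alg x (x_num q u %/ ('X - P.1%:P))
                  * horner_alg y (y_num q r P.2 %/ ('X - P.2%:P))).

End Indicator.

(* Main.v *)
Require Import Defs.
From HB Require Import structures.
From mathcomp Require Import all_boot all_order all_algebra finfield.
From mathcomp Require Import mpoly.

Set Implicit Arguments.
Unset Strict Implicit.
Unset Printing Implicit Defensive.

Import Order.TTheory GRing.Theory.
Local Open Scope ring_scope.

(** Put N = (q-1)u. A point (a, b) of X_u has a^(N+1) = a, because Tr(b) lies in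
    F_q; conversely both X^(N+1) - X and Tr(Y) - t, for t in F_q, divide
    X^(q^r) - X, so they split into distinct linear factors. Hence X_u has N+1
    columns of q^(r-1) points each, and no nonzero polynomial whose lex-leading
    monomial lies in the box [deg_x <= N, deg_y < q^(r-1)] vanishes on X_u.
    As Tr(y) - x^u and x^(N+1) - x belong to the ideal, the footprint is exactly
    this box; so the indicator function is unique, and it remains to evaluate f_P.
    At P the two quotients take the values of the derivatives of X^(N+1) - X at
    alpha and of Tr(Y) at beta, namely -1 (alpha = 0) or N = -u, and 1. *)

(** * Counting roots of divisors of X^#|F| - X *)

Section FiniteFieldRoots.

Variable F : finFieldType.

(** Over a finite field ['X^#|F| - 'X] is the product of all X - a, each once, so a divisor is up to
    a unit a subproduct. *)
Lemma card_roots_dvdp (p : {poly F}) :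
  p %| 'X^#|F| - 'X -> ((size p).-1 <= #|[set a | root p a]|)%N.
Proof.
rewrite finField_genPoly => /dvdp_prod_XsubC [m eqp].
rewrite (eqp_size eqp) size_prod_XsubC /= cardE.
apply: uniq_leq_size; first by rewrite mask_uniq // index_enum_uniq.
by move=> a am; rewrite mem_enum inE (eqp_root eqp) root_prod_XsubC.
Qed.

Lemma poly_eq0_card_roots (p : {poly F}) (A : {set F}) :
  (forall a, a \in A -> p.[a] = 0) -> (size p <= #|A|)%N -> p = 0.
Proof.
move=> pA0; apply: contraTeq => p0; rewrite -ltnNge cardE.
apply: max_poly_roots p0 _ (enum_uniq _).
by apply/allP => a; rewrite mem_enum => /pA0 /eqP.
Qed.

End FiniteFieldRoots.

(** * The trace and q-th powers *)

Section Trace.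

Variables (R : comNzRingType) (q r : nat).
Hypothesis charq : [pchar R].-nat q.

Let q_gt0 : (0 < q)%N. Proof. by case/andP: charq. Qed.

(** The q-th power is additive and shifts the summands of the trace by one, so the difference
    telescopes. The ring is general because the identity serves in F, F[X] and F[x, y]. *)
Lemma Tr_expq (z : R) : Tr q r z ^+ q - Tr q r z = z ^+ (q ^ r) - z.
Proof.
rewrite /Tr; elim: r => [|n IHn].
  by rewrite !big_ord0 expr0n expn0 expr1 (gtn_eqF q_gt0) !subrr.
rewrite !big_ord_recr /= exprDn_pchar // -exprM -expnSr opprD addrACA IHn.
by rewrite addrC addrA subrK.
Qed.

Lemma dvdr_expq_sub (z : R) : exists w, z ^+ q - z = w * z.
Proof.
by exists (z ^+ q.-1 - 1); rewrite mulrBl mul1r -exprSr prednK.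
Qed.

End Trace.

Lemma Tr_rmorph (R S : nzRingType) (f : {rmorphism R -> S}) q r z :
  f (Tr q r z) = Tr q r (f z).
Proof. by rewrite rmorph_sum; apply: eq_bigr => i _; rewrite rmorphXn. Qed.

(** * Powers and geometric sums *)

Lemma exprD_sub (R : nzRingType) (x : R) m n :
  x ^+ (m + n) - x ^+ n = (x ^+ m - 1) * x ^+ n.
Proof. by rewrite exprD mulrBl mul1r. Qed.

Lemma geometric_mul (R : comNzRingType) (x : R) n k :
  (x ^+ (n + 1) - x) * \sum_(i < k) x ^+ (n * i) = x ^+ (n * k + 1) - x.
Proof.
rewrite !(exprD_sub x _ 1) mulrAC exprM [in RHS]subrX1; congr (_ * _ * _).
by apply: eq_bigr => i _; rewrite exprM.
Qed.

(** For n = N this reduces x^(N+1) - x to x^#|F| - x and x^(qu) - x^u. In the geometric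
    factorisation of x^(nk+1) - x the summand i = 0 gives x^(n+1) - x; the others contain x^n
    (x^(n+1) - x) = x^(n+1-u) (x^(n+u) - x^u). *)
Lemma expr_geometric_reduce (R : comNzRingType) (x : R) n k u :
  (u <= n + 1)%N -> (0 < k)%N ->
  exists w, x ^+ (n + 1) - x
            = (x ^+ (n * k + 1) - x) - w * (x ^+ (n + u) - x ^+ u).
Proof.
move=> le_un; case: k => // k _.
exists (x ^+ (n + 1 - u) * \sum_(i < k) x ^+ (n * i)).
rewrite -geometric_mul big_ord_recl muln0 expr0 mulrDr mulr1.
apply/eqP; rewrite eq_sym subr_eq; apply/eqP; congr (_ + _).
have -> : \sum_(i < k) x ^+ (n * bump 0 i) = x ^+ n * \sum_(i < k) x ^+ (n * i).
  by rewrite mulr_sumr; apply: eq_bigr => i _; rewrite mulnS exprD.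
rewrite mulrCA mulrA [in RHS]mulrAC; congr (_ * _).
rewrite !mulrBr -!exprD -exprSr subnK //.
by rewrite [in RHS]addnCA subnK // addn1.
Qed.

(** * The univariate trace polynomial and quotients by X - a *)

Section UnivariateTrace.

Variable F : fieldType.

Lemma size_TrX q r (t : F) :
  (1 < q)%N -> size (Tr q r.+1 'X - t%:P : {poly F}) = (q ^ r).+1.
Proof.
move=> q1; rewrite size_polyDl /Tr big_ord_recr /=.
  rewrite addrC size_polyDl size_polyXn // ltnS.
  apply: leq_trans (size_sum _ _ _) _; apply/bigmax_leqP => i _.
  by rewrite size_polyXn ltn_exp2l.
rewrite addrC size_polyDl ?size_polyN size_polyXn.
  by rewrite size_polyC (leq_ltn_trans (leq_b1 _)) // ltnS expn_gt0 ltnW.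
rewrite ltnS.
apply: leq_trans (size_sum _ _ _) _; apply/bigmax_leqP => i _.
by rewrite size_polyXn ltn_exp2l.
Qed.

Lemma deriv_TrX q r : q%:R = 0 :> F -> (Tr q r.+1 'X : {poly F})^`() = 1.
Proof.
move=> q0; rewrite /Tr big_ord_recl expn0 expr1 derivD derivX raddf_sum /=.
rewrite big1 ?addr0 // => i _; rewrite derivXn -mulr_natr expnS natrM.
by rewrite -[q%:R]polyC_natr q0 polyC0 mul0r mulr0.
Qed.

Lemma horner_TrX q r (b : F) : (Tr q r 'X).[b] = Tr q r b.
Proof. by rewrite /Tr horner_sum; apply: eq_bigr => i _; rewrite hornerXn. Qed.

Lemma horner_divp_XsubC (p : {poly F}) a b :
  root p a -> p.[b] = (p %/ ('X - a%:P)).[b] * (b - a).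
Proof.
rewrite -dvdp_XsubCl => /divpK {1}<-.
by rewrite hornerM hornerXsubC.
Qed.

Lemma horner_divp_XsubC_deriv (p : {poly F}) a :
  root p a -> (p %/ ('X - a%:P)).[a] = p^`().[a].
Proof.
rewrite -dvdp_XsubCl => /divpK {2}<-.
by rewrite derivM derivXsubC mulr1 hornerD hornerM hornerXsubC subrr mulr0 add0r.
Qed.

End UnivariateTrace.

(** * Lexicographic leading monomials in two variables *)

Section LexMonomials.

Variable F : finFieldType.
Implicit Types (f g : {mpoly F[2]}) (m k : 'X_{1..2}).

Lemma mnm2P m m' : m ix = m' ix -> m iy = m' iy -> m = m'.
Proof.
move=> eqx eqy; apply/mnmP; case=> [[|[|//]] i2].
  by rewrite (_ : Ordinal i2 = ix) //; apply: val_inj.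
by rewrite (_ : Ordinal i2 = iy) //; apply: val_inj.
Qed.

(** The two equations are paired by a product of types so that one [rewrite] handles both
    coordinates. *)
Lemma mnm_xyE i j :
  ((U_(ix) *+ i + U_(iy) *+ j)%MM ix = i) * ((U_(ix) *+ i + U_(iy) *+ j)%MM iy = j).
Proof. by split; rewrite mnmDE !mulmnE !mnm1E /= mul0n mul1n ?addn0. Qed.

Lemma lex_leE m m' :
  lex_le m m' = ((m iy < m' iy) || (m iy == m' iy) && (m ix <= m' ix))%N.
Proof.
rewrite /lex_le leEprodlexi !leEnat /=.
by case: ltngtP => //= ->.
Qed.

Lemma lex_le_total : total lex_le.
Proof.
by move=> m m'; rewrite !lex_leE; case: ltngtP => //= _; exact: leq_total.
Qed.

Lemma lex_le_trans : transitive lex_le.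
Proof. by move=> ? ? ?; exact: le_trans. Qed.

Lemma lex_leD2l k m m' : lex_le m m' -> lex_le (k + m)%MM (k + m')%MM.
Proof. by rewrite !lex_leE !mnmDE ltn_add2l eqn_add2l leq_add2l. Qed.

Lemma leading_monomial_neq0 f m : leading_monomial f m -> f != 0.
Proof. by case=> fm _; apply: contraTneq fm => ->; rewrite msupp0. Qed.

Lemma leading_monomial_ex f : f != 0 -> exists m, leading_monomial f m.
Proof.
rewrite -msupp_eq0 /leading_monomial; elim: (msupp f) => // m [|m1 s] IHs _.
  exists m; split=> [|m']; rewrite !inE // => /eqP ->.
  by rewrite lex_leE eqxx leqnn orbT.
have [|n [sn n_max]] := IHs; first by [].
have [le_mn|le_nm] := orP (lex_le_total m n).
  exists n; split=> [|m']; first by rewrite inE sn orbT.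
  by rewrite inE => /orP[/eqP ->|/n_max].
exists m; split=> [|m']; first by rewrite inE eqxx.
rewrite inE => /orP[/eqP ->|/n_max le_m'n]; last exact: lex_le_trans le_nm.
by rewrite lex_leE eqxx leqnn orbT.
Qed.

Lemma leading_monomialXD m g :
    {in msupp g, forall m', lex_le m' m && (m' != m)} ->
  leading_monomial ('X_[m] + g) m.
Proof.
move=> g_lt; split.
  rewrite mcoeff_msupp mcoeffD mcoeffX eqxx [g@_m]memN_msupp_eq0.
    by rewrite addr0 oner_eq0.
  by apply/negP => /g_lt; rewrite eqxx andbF.
move=> m' /msuppD_le; rewrite mem_cat msuppX inE => /orP[/eqP ->|/g_lt/andP[]//].
by rewrite lex_leE eqxx leqnn orbT.
Qed.

Lemma leading_monomialMX f m k :
  leading_monomial f m -> leading_monomial (f * 'X_[k]) (k + m)%MM.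
Proof.
move=> [fm f_max]; split=> [|m']; rewrite (perm_mem (msuppMX _ _)).
  exact: map_f.
by case/mapP => n fn ->; apply/lex_leD2l/f_max.
Qed.

Lemma eval2E f (P : F * F) :
  eval2 f P = \sum_(m <- msupp f) f@_m * (P.1 ^+ m ix * P.2 ^+ m iy).
Proof.
rewrite /eval2 mevalE; apply: eq_bigr => m _; congr (_ * _).
rewrite big_ord_recl big_ord1 eqxx /=.
by congr (_ * _ ^+ m _); apply: val_inj.
Qed.

Lemma eval2X (i : 'I_2) j (P : F * F) :
  eval2 ('X_i ^+ j : {mpoly F[2]}) P = (if i == ix then P.1 else P.2) ^+ j.
Proof. by rewrite /eval2 rmorphXn /= mevalXU. Qed.

Lemma horner_algXE (i : 'I_2) (p : {poly F}) :
  horner_alg ('X_i : {mpoly F[2]}) p = \sum_(k < size p) p`_k *: 'X_i ^+ k.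
Proof.
rewrite -[p in LHS]coefK poly_def linear_sum /=; apply: eq_bigr => k _.
by rewrite linearZ /= rmorphXn /= horner_algX mulr_algl.
Qed.

Lemma eval2_horner_alg (i : 'I_2) (p : {poly F}) (P : F * F) :
  eval2 (horner_alg 'X_i p) P = p.[if i == ix then P.1 else P.2].
Proof.
rewrite horner_algXE horner_coef /eval2 raddf_sum; apply: eq_bigr => k _.
by rewrite /= mevalZ -/(eval2 _ P) eval2X.
Qed.

Lemma mcoeff_horner_algM (p s : {poly F}) m :
  (horner_alg 'X_ix p * horner_alg 'X_iy s : {mpoly F[2]})@_m
  = p`_(m ix) * s`_(m iy).
Proof.
(* Writing a coefficient as a sum of Kronecker deltas gives both sides the shape of one double
   sum. *)
have coefsum (t : {poly F}) n : t`_n = \sum_(i < size t) t`_i * (n == i)%:R.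
  rewrite -[t in LHS]coefK poly_def coef_sum.
  by apply: eq_bigr => i _; rewrite coefZ coefXn.
rewrite [p`_(m ix)]coefsum [s`_(m iy)]coefsum !horner_algXE !big_distrlr /=.
rewrite raddf_sum; apply: eq_bigr => i _.
rewrite raddf_sum; apply: eq_bigr => j _ /=.
rewrite -scalerAl -scalerAr scalerA !mpolyXn -mpolyXD mcoeffZ mcoeffX.
rewrite [in RHS]mulrACA -natrM mulnb; congr (_ * (nat_of_bool _)%:R).
apply/eqP/andP => [<-|[/eqP mi /eqP mj]]; first by rewrite !mnm_xyE !eqxx.
by apply: mnm2P; rewrite mnm_xyE.
Qed.

(* View f as a polynomial in y: for a in S it vanishes at more values of y than
   its degree, so its leading coefficient, a polynomial in x, vanishes on S. *)
Lemma vanishing_leading_monomial f (S : {set F}) (fibre : F -> {set F}) m :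
    (forall a b, a \in S -> b \in fibre a -> eval2 f (a, b) = 0) ->
    leading_monomial f m -> (m ix < #|S|)%N ->
  exists2 a, a \in S & (#|fibre a| <= m iy)%N.
Proof.
move=> f0 [fm f_max] ltmS; apply/exists_inP.
rewrite -[X in is_true X]negbK negb_exists_in; apply/negP => /forall_inP big_fibre.
have sizey m' : m' \in msupp f -> (m' iy <= m iy)%N.
  by move/f_max; rewrite lex_leE => /orP[/ltnW|/andP[/eqP ->]].
pose lc : {poly F} := \sum_(m' <- msupp f | m' iy == m iy) f@_m' *: 'X^(m' ix).
have lc0 : lc = 0.
  apply: (@poly_eq0_card_roots _ _ S) => [a Sa|]; last first.
    apply: leq_trans (size_sum _ _ _) _; apply/bigmax_leqP_seq => m' fm' /eqP eqy.
    apply: leq_trans (size_scale_leq _ _) _; rewrite size_polyXn.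
    apply: leq_ltn_trans ltmS.
    by move/f_max: fm'; rewrite lex_leE eqy ltnn eqxx.
  (* [fa] is f(a, Y); its coefficient at [m iy] is the value of [lc] at a. *)
  pose fa : {poly F} := \sum_(m' <- msupp f) (f@_m' * a ^+ m' ix) *: 'X^(m' iy).
  have fa0 : fa = 0.
    apply: (@poly_eq0_card_roots _ _ (fibre a)) => [b Sb|].
      rewrite -(f0 a b Sa Sb) eval2E horner_sum; apply: eq_bigr => m' _.
      by rewrite hornerZ hornerXn mulrA.
    apply: leq_trans (size_sum _ _ _) _; apply/bigmax_leqP_seq => m' fm' _.
    apply: leq_trans (size_scale_leq _ _) _; rewrite size_polyXn.
    by have := big_fibre a Sa; rewrite -ltnNge; apply/leq_ltn_trans/sizey.
  have := congr1 (fun p : {poly F} => p`_(m iy)) fa0.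
  rewrite coef0 coef_sum => fa_m; rewrite horner_sum -[RHS]fa_m [LHS]big_mkcond.
  apply: eq_bigr => m' _; rewrite coefZ coefXn eq_sym hornerZ hornerXn.
  by case: eqP; rewrite ?mulr1 ?mulr0.
(* The coefficient of [lc] at [m ix] is that of [f] at [m], which is nonzero: a contradiction. *)
have := congr1 (fun p : {poly F} => p`_(m ix)) lc0.
rewrite coef0 coef_sum big_mkcond (bigD1_seq m) //= ?msupp_uniq // eqxx.
rewrite coefZ coefXn eqxx mulr1 big1_seq ?addr0 => [/eqP|m' /andP[neqm _]].
  by rewrite mcoeff_eq0 fm.
case: eqP => // eqy; rewrite coefZ coefXn.
case: eqP => [eqx|]; last by rewrite mulr0.
by case/eqP: neqm; apply: mnm2P.
Qed.

End LexMonomials.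

(** * Membership in a finitely generated ideal *)

Section IdealGen.

Variables (R : comNzRingType) (gs : seq R).

Lemma ideal_gen_nth i : (i < size gs)%N -> ideal_gen gs gs`_i.
Proof.
move=> lt_i; exists (fun j => (val j == i)%:R).
rewrite (bigD1 (Ordinal lt_i)) //= eqxx mul1r big1 ?addr0 // => j neq_ji.
by rewrite -(inj_eq val_inj) /= in neq_ji; rewrite (negPf neq_ji) mul0r.
Qed.

Lemma ideal_genD f g : ideal_gen gs f -> ideal_gen gs g -> ideal_gen gs (f + g).
Proof.
move=> [a ->] [b ->]; exists (fun i => a i + b i).
by rewrite -big_split; apply: eq_bigr => i _; rewrite mulrDl.
Qed.

Lemma ideal_genM h f : ideal_gen gs f -> ideal_gen gs (h * f).
Proof.
move=> [a ->]; exists (fun i => h * a i).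
by rewrite mulr_sumr; apply: eq_bigr => i _; rewrite mulrA.
Qed.

Lemma ideal_genB f g : ideal_gen gs f -> ideal_gen gs g -> ideal_gen gs (f - g).
Proof. by move=> If Ig; rewrite -[g]mul1r -mulNr; apply/ideal_genD/ideal_genM. Qed.

End IdealGen.

(** * The points, ideal and footprint of X_u *)

Section FootprintBox.

Variables (F : finFieldType) (q r u : nat).
Hypotheses (charq : [pchar F].-nat q) (q_gt1 : (1 < q)%N).
Hypotheses (cardF : #|F| = (q ^ r.+1)%N) (u_gt0 : (0 < u)%N).
Hypothesis dvd_u : (u %| (q ^ r.+1 - 1) %/ (q - 1))%N.

Local Notation N := ((q - 1) * u)%N.
Local Notation x := ('X_ix : {mpoly F[2]}).
Local Notation y := ('X_iy : {mpoly F[2]}).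
Local Notation X_u := (ptsX F q r.+1 u).
Local Notation I_u := (@idealX F q r.+1 u).

Let N_gt0 : (0 < N)%N. Proof. by rewrite muln_gt0 subn_gt0 q_gt1. Qed.

Let Nu : (N + u = u * q)%N.
Proof. by rewrite addnC -mulSn subn1 prednK 1?mulnC // ltnW. Qed.

Lemma natq_eq0 : q%:R = 0 :> F.
Proof.
have pcharp : pdiv q \in [pchar F] by apply: pnatPpi charq _; rewrite pi_pdiv.
by apply/eqP; rewrite -(dvdn_pcharf pcharp) pdiv_dvd.
Qed.

(** The cofactor k of u in (q^(r+1) - 1)/(q - 1) gives N k = q^(r+1) - 1; it is positive because a
    field has more than one element. *)
Lemma cardF_geometric : exists2 k, (0 < k)%N & #|F| = (N * k + 1)%N.
Proof.
have [k Dk] := dvdnP dvd_u.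
have cardE : #|F| = (N * k + 1)%N.
  rewrite -mulnA [(u * k)%N]mulnC -Dk mulnC divnK.
    by rewrite subnK // expn_gt0 ltnW.
  by rewrite !subn1 dvdn_pred_predX.
exists k => //; case: k cardE {Dk} => //; rewrite muln0 => cardE.
by have := finNzRing_gt1 F; rewrite cardE.
Qed.

(** Read in F, the equality #|F| = N k + 1 becomes 0 = (q - 1) u k + 1, which fails if u
    vanishes. *)
Lemma natu_neq0 : u%:R != 0 :> F.
Proof.
have [k _ cardE] := cardF_geometric.
have : #|F|%:R = 0 :> F by rewrite cardF natrX natq_eq0 expr0n.
rewrite cardE natrD !natrM => /eqP; apply: contraTneq => ->.
by rewrite mulr0 mul0r add0r oner_eq0.
Qed.

Lemma size_x_num : size (x_num F q u) = N.+2.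
Proof.
rewrite /x_num addn1 size_polyDl ?size_polyXn // size_polyN size_polyX.
by rewrite !ltnS.
Qed.

(** As N + u = u q, each side says that a = 0 or a^N = 1. *)
Lemma root_x_num a : root (x_num F q u) a = (a ^+ (u * q) == a ^+ u).
Proof.
rewrite rootE !hornerE -Nu -[RHS]subr_eq0 !exprD_sub.
by rewrite !mulf_eq0 !expf_eq0 u_gt0.
Qed.

Lemma x_num_dvdp : x_num F q u %| 'X^#|F| - 'X.
Proof.
have [k _ ->] := cardF_geometric.
by rewrite -geometric_mul dvdp_mulIl.
Qed.

Lemma Tr_expq_fixed (b : F) : Tr q r.+1 b ^+ q = Tr q r.+1 b.
Proof. by apply/eqP; rewrite -subr_eq0 Tr_expq // -cardF expf_card subrr. Qed.

(** The hypothesis expresses that t lies in F_q. For z = Tr(X) - t it gives z^q - z = X^#|F| - X,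
    and z divides the left side. *)
Lemma TrX_sub_dvdp (t : F) :
  t ^+ q = t -> Tr q r.+1 'X - t%:P %| 'X^#|F| - 'X.
Proof.
move=> tq; have charPq : [pchar {poly F}].-nat q.
  by rewrite (eq_pnat _ (pchar_lalg _)).
have [w Ew] := dvdr_expq_sub charPq (Tr q r.+1 'X - t%:P).
apply/dvdpP; exists w; rewrite -Ew exprDn_pchar // cardF -(Tr_expq r.+1 charPq).
(* Expanding (t - t)^q = 0 additively gives the sign without a case split on the parity of q. *)
have -> : (- t%:P) ^+ q = - t%:P :> {poly F}.
  have /eqP := exprDn_pchar t%:P (- t%:P) charPq.
  rewrite subrr expr0n (gtn_eqF (ltnW q_gt1)) eq_sym -polyC_exp tq addrC.
  by rewrite addr_eq0 => /eqP.
by rewrite opprB addrA subrK.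
Qed.

Lemma ptsXE a b : ((a, b) \in X_u) = (a ^+ u == Tr q r.+1 b).
Proof. by rewrite inE. Qed.

Lemma ptsX_root_x a b : (a, b) \in X_u -> root (x_num F q u) a.
Proof. by rewrite ptsXE root_x_num exprM => /eqP ->; rewrite Tr_expq_fixed. Qed.

Lemma card_roots_x_num : (N < #|[set a | root (x_num F q u) a]|)%N.
Proof. by have := card_roots_dvdp x_num_dvdp; rewrite size_x_num. Qed.

(** By [root_x_num], a^u lies in F_q, so Tr(Y) - a^u has q^r distinct roots, and these lie in the
    column over a. *)
Lemma card_fibre a :
  root (x_num F q u) a -> (q ^ r <= #|[set b | (a, b) \in X_u]|)%N.
Proof.
rewrite root_x_num exprM => /eqP /TrX_sub_dvdp /card_roots_dvdp.
rewrite size_TrX //= => /leq_trans; apply; apply/subset_leq_card/subsetP => b.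
rewrite !inE rootE hornerD hornerN hornerC horner_TrX subr_eq0 /= => /eqP ->.
by rewrite eqxx.
Qed.

(** If m ix <= N, the presence of more than N columns forces one of them to have at most m iy
    points, while each has at least q^r. *)
Lemma vanishing_outside_box (f : {mpoly F[2]}) m :
    (forall P, P \in X_u -> eval2 f P = 0) -> leading_monomial f m ->
  ~~ ((m iy < q ^ r) && (m ix <= N))%N.
Proof.
move=> f0 fm; rewrite negb_and orbC -implybE; apply/implyP => le_mx.
have f0' a b : a \in [set a | root (x_num F q u) a] ->
  b \in [set b | (a, b) \in X_u] -> eval2 f (a, b) = 0.
  by move=> _; rewrite inE; apply: f0.
have ltmS := leq_ltn_trans le_mx card_roots_x_num.
have [a] := vanishing_leading_monomial f0' fm ltmS.
by rewrite inE -leqNgt => /card_fibre; apply: leq_trans.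
Qed.

Lemma idealX_vanish (f : {mpoly F[2]}) (P : F * F) :
  I_u f -> P \in X_u -> eval2 f P = 0.
Proof.
case: P => a b [h ->]; rewrite ptsXE => /eqP Dab.
rewrite /eval2 raddf_sum big1 // => -[[|[|[|//]]] lt_i] _; rewrite /= rmorphM /=.
- by rewrite rmorphB /= Tr_rmorph rmorphXn /= !mevalXU /= Dab subrr mulr0.
- by rewrite rmorphB rmorphXn /= !mevalXU /= -cardF expf_card subrr mulr0.
- by rewrite rmorphB rmorphXn /= !mevalXU /= -cardF expf_card subrr mulr0.
Qed.

Lemma idealX_y : I_u (Tr q r.+1 y - x ^+ u).
Proof. exact: (@ideal_gen_nth _ _ 0). Qed.

(* Modulo the ideal x^u = Tr(y), and Tr(y)^q = Tr(y), so x^(qu) = x^u; combined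
   with x^(q^r) = x this gives x^((q-1)u+1) = x. *)
Lemma idealX_x : I_u (x ^+ (N + 1) - x).
Proof.
have charMq : [pchar {mpoly F[2]}].-nat q by rewrite (eq_pnat _ (pchar_lalg _)).
have [k k_gt0 cardE] := cardF_geometric.
have le_uN : (u <= N + 1)%N.
  by apply: leq_trans (leq_addr _ _); rewrite leq_pmull // subn_gt0.
have [w ->] := expr_geometric_reduce x le_uN k_gt0.
apply: ideal_genB; first by rewrite -cardE cardF; exact: (@ideal_gen_nth _ _ 1).
apply: ideal_genM; have [v Ev] := dvdr_expq_sub charMq (Tr q r.+1 y - x ^+ u).
(* With g = Tr(y) - x^u, one has Tr(y)^q = g^q + x^(qu) and g^q - g = v g. *)
have -> : x ^+ (N + u) - x ^+ u
    = (y ^+ (q ^ r.+1) - y) - v * (Tr q r.+1 y - x ^+ u).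
  rewrite -Ev -(Tr_expq _ charMq) Nu exprM.
  have -> : Tr q r.+1 y ^+ q = (Tr q r.+1 y - x ^+ u) ^+ q + (x ^+ u) ^+ q.
    by rewrite -exprDn_pchar // subrK.
  by rewrite opprB !addrA subrK -[_ + _ - x ^+ u]addrA [RHS]addrAC subrr add0r.
apply: ideal_genB; first exact: (@ideal_gen_nth _ _ 2).
exact/ideal_genM/idealX_y.
Qed.

Lemma leading_monomial_Tr :
  leading_monomial (Tr q r.+1 y - x ^+ u) (U_(iy) *+ q ^ r)%MM.
Proof.
rewrite /Tr big_ord_recr /= [X in X - _]addrC -addrA (mpolyXn _ U_(iy)).
apply: leading_monomialXD => m /msuppB_le; rewrite mem_cat => /orP[].
  case/msupp_sum_le/flattenP => s /mapP[i _ ->].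
  rewrite mpolyXn msuppX inE => /eqP ->.
  have lt_qi : (q ^ i < q ^ r)%N by rewrite ltn_exp2l.
  rewrite lex_leE !mulmnE !mnm1E /= !mul1n lt_qi /=.
  apply: contraTneq lt_qi => /(congr1 (fun m : 'X_{1..2} => m iy)).
  by rewrite !mulmnE !mnm1E /= !mul1n => ->; rewrite ltnn.
rewrite mpolyXn msuppX inE => /eqP ->.
have qr_gt0 : (0 < q ^ r)%N by rewrite expn_gt0 ltnW.
rewrite lex_leE !mulmnE !mnm1E /= mul1n mul0n qr_gt0 /=.
apply: contraTneq qr_gt0 => /(congr1 (fun m : 'X_{1..2} => m iy)).
by rewrite !mulmnE !mnm1E /= mul1n => <-.
Qed.

Lemma leading_monomial_x_num :
  leading_monomial (x ^+ (N + 1) - x) (U_(ix) *+ (N + 1))%MM.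
Proof.
rewrite mpolyXn; apply: leading_monomialXD => m.
rewrite (perm_mem (msuppN _)) msuppX inE => /eqP ->.
rewrite lex_leE !mulmnE !mnm1E /= mul1n addn1 /=.
apply: contraTneq N_gt0 => /(congr1 (fun m : 'X_{1..2} => m ix)).
by rewrite !mulmnE !mnm1E /= mul1n => -[<-].
Qed.

(** A monomial outside the box is a multiple of y^(q^r) or x^(N+1), both leading monomials of
    elements of the ideal. One inside cannot lead an element of the ideal, by
    [vanishing_outside_box]. *)
Lemma footprint_idealXP m :
  footprint I_u m <-> ((m iy < q ^ r) && (m ix <= N))%N.
Proof.
split=> [foot_m|box_m [f [If _ fm]]]; last first.
  have f0 P : P \in X_u -> eval2 f P = 0 by apply: idealX_vanish.
  by have := vanishing_outside_box f0 fm; rewrite box_m.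
have multiple g n : I_u g -> leading_monomial g n -> (n <= m)%MM -> False.
  move=> Ig gn le_nm; apply: foot_m.
  have := leading_monomialMX (m - n)%MM gn; rewrite submK // => gm.
  exists (g * 'X_[(m - n)]); split=> //; last exact: leading_monomial_neq0 gm.
  by rewrite mulrC; apply: ideal_genM.
apply/andP; split; rewrite leqNgt; apply/negP => le_m.
  apply: (multiple _ _ idealX_y leading_monomial_Tr); apply/mnm_lepP => i.
  rewrite mulmnE mnm1E; case: eqP => [<-|_]; last by rewrite mul0n.
  by rewrite mul1n -ltnS.
apply: (multiple _ _ idealX_x leading_monomial_x_num); apply/mnm_lepP => i.
rewrite mulmnE mnm1E; case: eqP => [<-|_]; last by rewrite mul0n.
by rewrite mul1n addn1.
Qed.

(** The difference of two indicators vanishes on X_u while its support stays in the box, so it has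
    no leading monomial. *)
Lemma footprint_indicator_unique (P : F * F) (f g : {mpoly F[2]}) :
    footprint_indicator q r.+1 u P f -> footprint_indicator q r.+1 u P g ->
  f = g.
Proof.
move=> [foot_f f1 f0] [foot_g g1 g0]; apply/eqP; rewrite -subr_eq0.
apply/negPn/negP => /leading_monomial_ex[m fgm].
have fg0 Q : Q \in X_u -> eval2 (f - g) Q = 0.
  move=> XQ; rewrite /eval2 rmorphB /= -!/(eval2 _ _).
  have [->|neqQ] := eqVneq Q P; first by rewrite f1 g1 subrr.
  by rewrite f0 // g0 // subrr.
have /negP[] := vanishing_outside_box fg0 fgm.
case: fgm => /msuppB_le; rewrite mem_cat => /orP[/foot_f|/foot_g] + _;
  by move/footprint_idealXP.
Qed.

(** * Values and leading monomial of f_P *)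

Variables alpha beta : F.
Hypothesis ab_X : (alpha, beta) \in X_u.

Local Notation A := (x_num F q u %/ ('X - alpha%:P)).
Local Notation B := (y_num q r.+1 beta %/ ('X - beta%:P)).
Local Notation f_P := (fP q r.+1 u (alpha, beta)).

Lemma root_y_num : root (y_num q r.+1 beta) beta.
Proof. by rewrite rootE hornerD hornerN hornerC horner_TrX subrr. Qed.

Lemma size_x_quot : size A = N.+1.
Proof. by rewrite size_divp ?polyXsubC_eq0 // size_XsubC size_x_num subn1. Qed.

Lemma size_y_quot : size B = (q ^ r)%N.
Proof. by rewrite size_divp ?polyXsubC_eq0 // size_XsubC size_TrX ?subn1. Qed.

Lemma fP_coef_neq0 : fP_coef u alpha != 0.
Proof.
rewrite /fP_coef; case: (alpha == 0); first by rewrite oppr_eq0 oner_eq0.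
by rewrite invr_eq0 oppr_eq0 natu_neq0.
Qed.

Lemma mcoeff_fP m : f_P@_m = fP_coef u alpha * (A`_(m ix) * B`_(m iy)).
Proof. by rewrite mcoeffZ mcoeff_horner_algM. Qed.

Lemma eval2_fP (Q : F * F) : eval2 f_P Q = fP_coef u alpha * (A.[Q.1] * B.[Q.2]).
Proof.
by rewrite /eval2 mevalZ rmorphM /= -!/(eval2 _ _) !eval2_horner_alg.
Qed.

Lemma msupp_fP m :
  m \in msupp f_P -> ((m iy < q ^ r) && (m ix <= N))%N.
Proof.
rewrite mcoeff_msupp mcoeff_fP; apply: contraNT; rewrite negb_and -!leqNgt -ltnNge.
case/orP => le_m; first by rewrite [B`__]nth_default ?size_y_quot // !mulr0.
by rewrite [A`__]nth_default ?size_x_quot // mul0r mulr0.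
Qed.

Lemma eval2_fP_self : eval2 f_P (alpha, beta) = 1.
Proof.
have root_a := ptsX_root_x ab_X.
rewrite eval2_fP !horner_divp_XsubC_deriv ?root_y_num //=.
have -> : (y_num q r.+1 beta)^`() = 1.
  by rewrite derivB deriv_TrX ?natq_eq0 // derivC subr0.
rewrite hornerC mulr1 /x_num addn1 derivB derivXn derivX.
rewrite hornerD hornerN hornerC hornerMn hornerXn /=.
rewrite -mulr_natl /fP_coef; case: eqP => [->|/eqP a_neq0].
  by rewrite expr0n (gtn_eqF N_gt0) mulr0 sub0r mulrNN mulr1.
have aN : alpha ^+ N = 1.
  move: root_a; rewrite rootE /x_num !hornerE exprD_sub.
  by rewrite mulf_eq0 (negPf a_neq0) orbF subr_eq0 => /eqP.
(* In F the remaining factor (N + 1) - 1 = (q - 1) u equals -u, which c inverts. *)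
rewrite aN mulr1 -addn1 natrD addrK natrM natrB 1?ltnW // natq_eq0 sub0r mulN1r.
by rewrite mulVf // oppr_eq0 natu_neq0.
Qed.

(** In another column the x-quotient vanishes. In the column of alpha, Tr(b) = alpha^u = Tr(beta),
    so b is a further root of Tr(Y) - Tr(beta) and the y-quotient vanishes. *)
Lemma eval2_fP_other (Q : F * F) :
  Q \in X_u -> Q != (alpha, beta) -> eval2 f_P Q = 0.
Proof.
case: Q => a b XQ neqQ; have root_a := ptsX_root_x ab_X.
rewrite eval2_fP /=; have [Da|neq_a] := eqVneq a alpha.
  have neq_b : b - beta != 0.
    by rewrite subr_eq0; apply: contraNneq neqQ => ->; rewrite Da.
  suff -> : B.[b] = 0 by rewrite !mulr0.
  apply: (mulIf neq_b); rewrite -horner_divp_XsubC ?root_y_num // mul0r.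
  rewrite hornerD hornerN hornerC horner_TrX; apply/eqP; rewrite subr_eq0.
  by move: XQ ab_X; rewrite !ptsXE Da => /eqP <- /eqP ->.
suff -> : A.[a] = 0 by rewrite mul0r mulr0.
have := ptsX_root_x XQ; rewrite rootE (horner_divp_XsubC _ root_a) mulf_eq0.
by rewrite subr_eq0 (negPf neq_a) orbF => /eqP.
Qed.

Lemma fP_standard_indicator : standard_indicator q r.+1 u (alpha, beta) f_P.
Proof.
have fPind : footprint_indicator q r.+1 u (alpha, beta) f_P.
  split=> [m /msupp_fP /footprint_idealXP //| |]; first exact: eval2_fP_self.
  exact: eval2_fP_other.
by split=> // g; apply: footprint_indicator_unique.
Qed.

(** The monomial is the lex-largest corner of the box containing the support; its coefficient is c
    times the leading coefficients of the two quotients. *)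
Lemma leading_monomial_fP :
  leading_monomial f_P (U_(iy) *+ (q ^ r - 1) + U_(ix) *+ N)%MM.
Proof.
rewrite addmC; split=> [|m /msupp_fP/andP[lt_y le_x]].
  rewrite mcoeff_msupp mcoeff_fP !mnm_xyE !mulf_neq0 ?fP_coef_neq0 //.
    have -> : N = (size A).-1 by rewrite size_x_quot.
    by rewrite -lead_coefE lead_coef_eq0 -size_poly_eq0 size_x_quot.
  rewrite subn1 -size_y_quot -lead_coefE lead_coef_eq0 -size_poly_eq0.
  by rewrite size_y_quot -lt0n expn_gt0 ltnW.
rewrite lex_leE !mnm_xyE le_x andbT orbC -leq_eqVlt.
by rewrite -ltnS subn1 prednK // expn_gt0 ltnW.
Qed.

End FootprintBox.

(** The two divisibilities record that the Euclidean quotients in [fP] are exact. *)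
Theorem theorem3p2 (F : finFieldType) (q r u : nat)
    (hq : prime_power q) (hr : (2 <= r)%N) (hF : #|F| = (q ^ r)%N)
    (hu0 : (0 < u)%N) (hu : (u %| (q ^ r - 1) %/ (q - 1))%N)
    (alpha beta : F) (hP : (alpha, beta) \in ptsX F q r u) :
  [/\ 'X - alpha%:P %| x_num F q u,
      'X - beta%:P %| y_num q r beta,
      standard_indicator q r u (alpha, beta) (fP q r u (alpha, beta))
    & forall f : {mpoly F[2]}, standard_indicator q r u (alpha, beta) f ->
        leading_monomial f
          (U_(iy) *+ (q ^ (r - 1) - 1) + U_(ix) *+ ((q - 1) * u))%MM].
Proof.
have [p [k [p_pr k_gt0 Dq]]] := hq.
have q_gt1 : (1 < q)%N by rewrite Dq -(exp1n k) ltn_exp2r // prime_gt1.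
have charq : [pchar F].-nat q.
  rewrite Dq pnatX pnatE //; apply/orP; left.
  by apply: (@card_finPcharP _ _ (k * r)); rewrite // hF Dq expnM.
(* Passing to [r.+1] turns the exponent r - 1 into [r], as in the lemmas above. *)
case: r hr hF hu hP => // r _ hF hu hP; rewrite !dvdp_XsubCl subSS subn0.
have fP_std := fP_standard_indicator charq q_gt1 hF hu0 hu hP.
split=> //; first exact: (ptsX_root_x _ _ _ _ hP).
  exact: root_y_num.
by move=> f [f_ind /(_ _ (proj1 fP_std)) ->]; apply: leading_monomial_fP.
Qed.
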